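(* There exists a graph on $64$ vertices with girth exactly $6$ and chromatic number $4$. Consequently $n_6(4)\le 64$.
   Context: Graphs are finite, simple and undirected. The girth of a graph is the length of a shortest cycle (infinite if there is no cycle). For integers $k,g\ge 3$, $n_g(k)$ denotes the minimum number of vertices of a graph with chromatic number $k$ and girth at least $g$. *)

(* Defs.v *)
From mathcomp Require Import all_boot.

Set Implicit Arguments.
Unset Strict Implicit.
Unset Printing Implicit Defensive.

Record sgraph := SGraph {
  vertex :> finType;
  adj : rel vertex;
  adj_sym : symmetric adj;
  adj_irrefl : irreflexive adj
}.

(* [path.cycle] also accepts sequences of size at most 2, in particular an edge
   traversed back and forth, hence the size condition. *)
Definition graph_cycle (G : sgraph) (c : seq G) : bool :=
  [&& 3 <= size c, uniq c & cycle (@adj G) c].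

Definition has_cycle_of_length (G : sgraph) (n : nat) : bool :=
  [exists c : n.-tuple G, graph_cycle c].

(* [None] stands for infinity. A cycle has no repeated vertex, so only the
   lengths up to #|G| have to be searched; see [girth_SomeP] and
   [girth_NoneP]. *)
Definition girth (G : sgraph) : option nat :=
  ohead [seq n <- iota 0 #|G|.+1 | has_cycle_of_length G n].

Definition girth_at_least (g : nat) (G : sgraph) : Prop :=
  if girth G is Some n then g <= n else True.

Definition proper_coloring (G : sgraph) (k : nat) (f : {ffun G -> 'I_k}) : bool :=
  [forall x, forall y, adj x y ==> (f x != f y)].

Definition colorable (G : sgraph) (k : nat) : bool :=
  [exists f : {ffun G -> 'I_k}, proper_coloring f].

Lemma ex_colorable (G : sgraph) : exists k, colorable G k.
Proof.
exists #|G|; apply/existsP; exists [ffun x => enum_rank x].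
apply/forallP=> x; apply/forallP=> y; apply/implyP=> xy; rewrite !ffunE.
by apply: contraTneq xy => /enum_rank_inj ->; rewrite adj_irrefl.
Qed.

Definition chromatic_number (G : sgraph) : nat := ex_minn (ex_colorable G).

Definition chromatic_girth_order (g k n : nat) : Prop :=
  exists G : sgraph,
    [/\ #|G| = n, chromatic_number G = k & girth_at_least g G].

(* n is the minimum number of vertices of a graph with chromatic number k and
   girth at least g, usually written n_g(k). It is a relation because that some graph has chromatic number
   k and girth at least g is itself a theorem. *)
Definition is_min_order (g k n : nat) : Prop :=
  chromatic_girth_order g k n /\
  forall m, chromatic_girth_order g k m -> n <= m.

Lemma has_cycle_of_lengthP (G : sgraph) n :
  reflect (exists2 c : seq G, graph_cycle c & size c = n)
          (has_cycle_of_length G n).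
Proof.
apply: (iffP existsP) => [[c cP]|[c cP <-]].
  by exists c; rewrite ?size_tuple.
by exists (in_tuple c).
Qed.

Lemma graph_cycle_size (G : sgraph) (c : seq G) :
  graph_cycle c -> size c <= #|G|.
Proof. by case/and3P=> _ /card_uniqP <- _; exact: max_card. Qed.

Lemma girth_NoneP (G : sgraph) :
  girth G = None <-> forall c : seq G, ~~ graph_cycle c.
Proof.
rewrite /girth; split=> [|noc].
  case E: [seq _ <- _ | _] => [|//] _ c; apply/negP=> cP.
  suff: size c \in [::] by []; rewrite -E mem_filter mem_iota /= add0n ltnS.
  by rewrite graph_cycle_size // andbT; apply/has_cycle_of_lengthP; exists c.
rewrite (_ : [seq _ <- _ | _] = [::]) //; apply/eqP; rewrite -[_ == _]negbK.
rewrite -has_filter; apply/hasPn=> n _; apply/has_cycle_of_lengthP=> -[c cP _].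
by rewrite (negPf (noc c)) in cP.
Qed.

Lemma girth_SomeP (G : sgraph) n :
  girth G = Some n <->
  (exists2 c : seq G, graph_cycle c & size c = n) /\
  (forall c : seq G, graph_cycle c -> n <= size c).
Proof.
have min m : girth G = Some m ->
  (exists2 c : seq G, graph_cycle c & size c = m) /\
  (forall c : seq G, graph_cycle c -> m <= size c).
  rewrite /girth; case E: [seq _ <- _ | _] => [//|p s] [<-]; split.
    have: p \in p :: s by rewrite mem_head.
    by rewrite -E mem_filter => /andP[/has_cycle_of_lengthP].
  move=> c cP.
  have: size c \in p :: s.
    rewrite -E mem_filter mem_iota /= add0n ltnS graph_cycle_size // andbT.
    by apply/has_cycle_of_lengthP; exists c.
  have: sorted leq (p :: s).
    by rewrite -E; apply: (sorted_filter leq_trans); apply: iota_sorted.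
  rewrite /= (path_sortedE leq_trans) => /andP[/allP ps _].
  by rewrite inE => /orP[/eqP-> //|/ps].
split=> [/min //|[[c cP cn] cmin]].
case E: (girth G) => [m|]; last by move/girth_NoneP/(_ c): E; rewrite cP.
have [[d dP dm] dmin] := min _ E; congr Some; apply/eqP.
by rewrite eqn_leq -{1}cn dmin // -dm cmin.
Qed.

(* Main.v *)
Require Import Defs.
From mathcomp Require Import all_boot.
From Stdlib Require Import Classical_Prop.

Set Implicit Arguments.
Unset Strict Implicit.
Unset Printing Implicit Defensive.

(** The witness is a graph on which the alternating group A4 acts with a free
    action on 60 vertices and the natural action on the other four. Seen as the
    group of the maps [p |-> w^i p + t] of the field with four elements, A4 has
    the points of the field as an orbit of size 4; the graph consists of these
    four points and of five copies of A4, joined along 15 families of edges,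
    each invariant under left translation by A4. An invariant family is
    determined by one of its edges, so the whole graph is given by 13 elements
    of A4, for the families that join copies of A4, and 2 points, for the
    families that reach the field (see [voltages] and [anchors]).

    The graph has 4 colours because of an equivariant map: colour the point [p]
    by [p] itself, and the element [g] of the copy [b] by [g p_b] for a suitable
    point [p_b]. An edge family is properly coloured as soon as one of its edges
    is, since A4 permutes the colours, so choosing the five points [p_b] only
    has to meet one condition per family.

    That three colours do not suffice, and that no cycle is shorter than 6, has
    no short explanation: both are finite searches. For the colouring the search
    keeps, for each uncoloured vertex, the list of colours still allowed there,
    and branches on a vertex with the fewest ([uncolorable],
    [uncolorable_sound]). The colours of the two ends of one edge are fixed
    beforehand by permuting colours ([colorable3_edge]), and then about 23000
    nodes are visited. For the girth the search extends simple paths and looks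
    for a closing edge ([closes], [cycle_closes]).

    The order of this graph makes the set of orders of 4-chromatic graphs of
    girth at least 6 nonempty, and its least element is at most 64. *)

(** * Refuting colourings by search *)

Section ListColoring.

Variables (T C : eqType) (e : rel T).
Implicit Types (L : seq (T * seq C)) (p : T * seq C).

(** The first entry with the fewest colours, and the other entries in their
    original order: branching there keeps the search tree small. *)
Fixpoint pull L : option ((T * seq C) * seq (T * seq C)) :=
  if L is p :: L' then
    if pull L' is Some (q, M) then
      if size p.2 <= size q.2 then Some (p, L') else Some (q, p :: M)
    else Some (p, [::])
  else None.

Definition restrict (near : pred T) (c : C) L :=
  [seq (p.1, if near p.1 then [seq d <- p.2 | d != c] else p.2) | p <- L].

Fixpoint uncolorable (n : nat) L : bool :=
  if n is n'.+1 then
    if pull L is Some (p, M) then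
      (* [e] may do preliminary work on its first argument: it is done once
         here, not once per remaining vertex. *)
      let near := e p.1 in
      all (fun c => uncolorable n' (restrict near c M)) p.2
    else false
  else false.

Lemma pull_perm L p M : pull L = Some (p, M) -> perm_eq L (p :: M).
Proof.
elim: L p M => //= q L IHL p M.
case E: (pull L) => [[r N]|]; last first.
  case: L E {IHL} => [|r L] /=; first by move=> _ [<- <-].
  by case: (pull L) => [[? ?]|] //; case: ifP => _.
case: ifP => _ [<- <-] //.
apply: (@perm_trans _ (q :: r :: N)); first by rewrite perm_cons IHL.
exact: permEl (perm_catCA [:: q] [:: r] N).
Qed.

(** Whatever vertex the search branches on, a colouring that respects the lists
    survives in the branch of the colour it gives to that vertex; so the choice
    made by [pull] matters for speed only. *)
Lemma uncolorable_sound (f : T -> C) n L :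
    (forall x y, e x y -> f x != f y) -> all (fun p => f p.1 \in p.2) L ->
  ~~ uncolorable n L.
Proof.
move=> fe; elim: n L => //= n IHn L fL.
case E: (pull L) => [[p M]|//].
have := fL; rewrite (perm_all _ (pull_perm E)) /= => /andP[fp fM].
apply/allPn; exists (f p.1) => //; apply: IHn.
rewrite all_map; apply: sub_all fM => q /= fq.
by case: ifP => // /fe; rewrite mem_filter fq eq_sym => ->.
Qed.

End ListColoring.

(** * Detecting short cycles by search *)

Section ShortCycle.

Variables (T : eqType) (e : rel T) (nb : T -> seq T).

(** [vis] lists the vertices of a simple path from [a] to [u], which is extended
    by at most [k] vertices. *)
Fixpoint closes (k : nat) (a u : T) (vis : seq T) : bool :=
  (2 < size vis) && (a \in nb u) ||
  (if k is k'.+1 then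
     has (fun w => (w \notin vis) && closes k' a w (w :: vis)) (nb u)
   else false).

Hypothesis nbP : forall x y, e x y -> y \in nb x.

(** Uniqueness of [p ++ vis] lets the search follow [p] without meeting a
    visited vertex, and the last edge closes the cycle at [a]. *)
Lemma path_closes k a u p vis :
    path e u p -> e (last u p) a -> uniq (p ++ vis) ->
    2 < size p + size vis -> size p <= k ->
  closes k a u vis.
Proof.
elim: p k u vis => [|w p IHp] k u vis /=.
  by move=> _ ua _ sz _; case: k => [|k] /=; rewrite -[size vis]add0n sz nbP.
case: k => // k /andP[uw wp] pa /andP[].
rewrite mem_cat negb_or => /andP[wNp wv] up sz pk.
apply/orP; right; apply/hasP; exists w; first exact: nbP.
rewrite wv /=; apply: IHp => //=; last by rewrite addnS -addSn.
by rewrite uniq_catC /= mem_cat negb_or wNp wv uniq_catC.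
Qed.

Lemma cycle_closes k x p :
    uniq (x :: p) -> cycle e (x :: p) -> 1 < size p -> size p <= k ->
  closes k x x [:: x].
Proof.
move=> xp; rewrite /= rcons_path => /andP[ep px] p1 pk.
by apply: (path_closes ep px) => //; rewrite ?addn1 // cats1 rcons_uniq.
Qed.

End ShortCycle.

(** * The group A4 and the graph *)

(** The field with four elements is coded by [0 .. 3], with [1] as its unit and
    [2] as the generator [w] of its multiplicative group, so that its addition
    is bitwise exclusive or. *)
Definition f4_add (s t : nat) : nat :=
  nth 0 (nth [::] [:: [:: 0; 1; 2; 3]; [:: 1; 0; 3; 2];
                      [:: 2; 3; 0; 1]; [:: 3; 2; 1; 0]] s) t.

Definition f4_mulw (i t : nat) : nat := iter i (nth 0 [:: 0; 2; 3; 1]) t.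

(** The pair [(t, i)] stands for the affine map [p |-> w^i p + t]. *)
Definition a4_act (g : nat * nat) (p : nat) : nat := f4_add g.1 (f4_mulw g.2 p).

Definition a4_mul (g h : nat * nat) : nat * nat :=
  (a4_act g h.1, (g.2 + h.2) %% 3).

Definition a4_elements : seq (nat * nat) :=
  [seq (t, i) | i <- iota 0 3, t <- iota 0 4].

(** The codes [0 .. 3] are left to the points of the field; the five copies of
    A4, numbered by [b], follow in blocks of 12. *)
Definition vertex_code (b : nat) (g : nat * nat) : nat :=
  4 + 12 * b + index g a4_elements.

(** The entry [(b, b', s)] joins [g] in copy [b] to [g s] in copy [b'], for all
    [g]. In the four entries with [b = b'] the voltage is an involution, and
    only 6 edges arise. *)
Definition voltages : seq (nat * nat * (nat * nat)) :=
  [:: (0, 0, (1, 0)); (1, 1, (1, 0)); (2, 2, (1, 0)); (3, 3, (3, 0));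
      (1, 0, (1, 1)); (1, 0, (2, 2)); (2, 1, (0, 1)); (2, 0, (3, 1));
      (4, 2, (0, 0)); (4, 2, (0, 1));
      (3, 1, (0, 0)); (3, 0, (0, 0)); (3, 4, (0, 0))].

(** The entry [(b, p)] joins [g] in copy [b] to the point [g p], for all [g]. *)
Definition anchors : seq (nat * nat) := [:: (3, 0); (4, 2)].

Definition edges : seq (nat * nat) :=
  [seq (vertex_code v.1.1 g, vertex_code v.1.2 (a4_mul g v.2))
     | v <- voltages, g <- a4_elements]
  ++ [seq (vertex_code a.1 g, a4_act g a.2) | a <- anchors, g <- a4_elements].

(* The adjacency matrix and the neighbour lists are stored in evaluated form,
   because the searches read them many times. *)
Definition rows : seq bitseq := Eval vm_compute in
  [seq [seq ((x, y) \in edges) || ((y, x) \in edges) | y <- iota 0 64]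
     | x <- iota 0 64].

Definition adjb (x : nat) : pred nat :=
  let row := nth [::] rows x in fun y => nth false row y.

Definition neighbours : seq (seq nat) := Eval vm_compute in
  [seq [seq y <- iota 0 64 | adjb x y] | x <- iota 0 64].

Definition nbrs (x : nat) : seq nat := nth [::] neighbours x.

Lemma all_iota n (P : pred nat) : all P (iota 0 n) -> forall x, x < n -> P x.
Proof. by move=> /allP nP x xn; apply: nP; rewrite mem_iota. Qed.

Lemma adjb_lt x y : adjb x y -> (x < 64) && (y < 64).
Proof.
have rows64: all (fun r => size r == 64) rows by vm_compute.
have rows_size : size rows = 64 by [].
rewrite /adjb; case: (ltnP x 64) => x64; last first.
  by rewrite [nth [::] _ _]nth_default ?rows_size // nth_nil.
rewrite -rows_size in x64; have/eqP rn := allP rows64 _ (mem_nth [::] x64).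
by case: (ltnP y 64) => // y64; rewrite nth_default // rn.
Qed.

Lemma adjb_sym : symmetric adjb.
Proof.
have sym: all (fun x => all (fun y => adjb x y == adjb y x) (iota 0 64))
              (iota 0 64) by vm_compute.
have imp x y : adjb x y -> adjb y x.
  move=> xy; have /andP[x64 y64] := adjb_lt xy.
  by rewrite -(eqP (all_iota (all_iota sym x64) y64)).
by move=> x y; apply/idP/idP; apply: imp.
Qed.

Lemma adjb_irrefl : irreflexive adjb.
Proof.
move=> x; apply/negP=> xx; have /andP[x64 _] := adjb_lt xx.
have irr: all (fun x => ~~ adjb x x) (iota 0 64) by vm_compute.
by have := all_iota irr x64; rewrite xx.
Qed.

Lemma adjb_nbrs x y : adjb x y -> y \in nbrs x.
Proof.
move=> xy; have /andP[x64 y64] := adjb_lt xy.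
have -> : nbrs x = [seq y <- iota 0 64 | adjb x y].
  apply/eqP; move: x x64 {xy}; apply: all_iota.
  by vm_compute.
by rewrite mem_filter xy mem_iota.
Qed.

Definition a4_graph : sgraph :=
  @SGraph 'I_64 (fun x y => adjb x y)
    (fun x y => adjb_sym x y) (fun x => adjb_irrefl x).

(** * Girth *)

Lemma a4_graph_girth : girth a4_graph = Some 6.
Proof.
apply/girth_SomeP; split.
  exists [:: @Ordinal 64 0 isT; @Ordinal 64 40 isT; @Ordinal 64 4 isT;
             @Ordinal 64 5 isT; @Ordinal 64 39 isT; @Ordinal 64 59 isT] => //.
have none: all (fun x => ~~ closes nbrs 4 x x [:: x]) (iota 0 64) by vm_compute.
case=> [//|x p] /and3P[] /= p1 xp cp; rewrite leqNgt; apply/negP=> p6.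
have /negP[] := all_iota none (ltn_ord x).
apply: (cycle_closes (e := adjb) adjb_nbrs (p := map val p)).
- by rewrite -map_cons (map_inj_uniq val_inj).
- by rewrite -map_cons cycle_map.
- by rewrite size_map.
- by rewrite size_map.
Qed.

(** * Chromatic number *)

Lemma properP (G : sgraph) k (f : {ffun G -> 'I_k}) :
  reflect (forall x y, adj x y -> f x != f y) (proper_coloring f).
Proof.
apply: (iffP forallP) => [fP x y|fP x].
  by move: (fP x) => /forallP/(_ y)/implyP.
by apply/forallP=> y; apply/implyP; apply: fP.
Qed.

Lemma colorable_widen (G : sgraph) k l :
  k <= l -> colorable G k -> colorable G l.
Proof.
move=> kl /existsP[f /properP fP]; apply/existsP.
exists [ffun x => widen_ord kl (f x)]; apply/properP=> x y xy.
by rewrite !ffunE; apply: contra (fP x y xy) => /eqP [/val_inj ->].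
Qed.

(** With three colours, those of the ends of an edge determine how to rename all
    of them: the remaining colour becomes 2. *)
Lemma colorable3_edge (G : sgraph) (u v : G) :
    adj u v -> colorable G 3 ->
  exists f : {ffun G -> 'I_3},
    [/\ proper_coloring f, val (f u) = 0 & val (f v) = 1].
Proof.
move=> uv /existsP[f /properP fP].
pose s (a b c : 'I_3) : 'I_3 :=
  if c == a then @Ordinal 3 0 isT
  else if c == b then @Ordinal 3 1 isT else @Ordinal 3 2 isT.
have s_inj a b c d : a != b -> c != d -> s a b c != s a b d.
  by move: a b c d; do 4!case=> [[|[|[|//]]] ?].
exists [ffun x => s (f u) (f v) (f x)]; split.
- by apply/properP=> x y xy; rewrite !ffunE s_inj ?fP.
- by rewrite ffunE /s eqxx.
- by rewrite ffunE /s eq_sym (negPf (fP _ _ uv)) eqxx.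
Qed.

(** Fixing the colours of the adjacent vertices 4 and 5 divides the search by
    the six permutations of the colours. *)
Definition start : seq (nat * seq nat) :=
  [seq (x, if x == 4 then [:: 0] else if x == 5 then [:: 1] else [:: 0; 1; 2])
     | x <- iota 0 64].

(** Each level of the search colours one of the 64 vertices, so a bound of 65
    levels cannot cut it short. *)
Lemma start_uncolorable : uncolorable adjb 65 start.
Proof. by vm_cast_no_check (erefl true). Qed.

Lemma a4_graph_not_colorable3 : ~~ colorable a4_graph 3.
Proof.
have e45: @adj a4_graph (@Ordinal 64 4 isT) (@Ordinal 64 5 isT) by [].
apply/negP=> /(colorable3_edge e45)[f [/properP fP f4 f5]].
pose F x := val (f (inord x : 'I_64)).
have F4 : F 4 = 0.
  rewrite /F (_ : inord 4 = @Ordinal 64 4 isT) //.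
  by apply: val_inj; rewrite /= inordK.
have F5 : F 5 = 1.
  rewrite /F (_ : inord 5 = @Ordinal 64 5 isT) //.
  by apply: val_inj; rewrite /= inordK.
suff /negP : ~~ uncolorable adjb 65 start by apply; apply: start_uncolorable.
apply: (@uncolorable_sound _ _ _ F) => [x y xy|].
  have /andP[x64 y64] := adjb_lt xy.
  by rewrite (inj_eq val_inj); apply: fP; rewrite /= !inordK.
rewrite all_map; apply/allP=> x _ /=.
case: (x =P 4) => [->|_]; first by rewrite F4.
case: (x =P 5) => [->|_]; first by rewrite F5.
by rewrite /F; case: (f _) => -[|[|[|]]].
Qed.

(** The colouring [p |-> p], [g |-> g p_b], listed in the order of the vertices;
    the list of the [p_b] is one of the many that satisfy the 15 conditions. *)
Definition equivariant_coloring : seq nat :=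
  iota 0 4 ++ [seq a4_act g p | p <- [:: 0; 0; 1; 1; 0], g <- a4_elements].

Lemma a4_graph_colorable4 : colorable a4_graph 4.
Proof.
pose c x := nth 0 equivariant_coloring x.
have c4: all (fun x => c x < 4) (iota 0 64) by vm_compute.
have cP: all (fun x => all (fun y => adjb x y ==> (c x != c y)) (iota 0 64))
             (iota 0 64) by vm_compute.
apply/existsP; exists [ffun x : 'I_64 => inord (c x)]; apply/properP=> x y xy.
have c4x (z : 'I_64) : c z < 4 := all_iota c4 (ltn_ord z).
rewrite !ffunE -(inj_eq val_inj) /= (inordK (c4x x)) (inordK (c4x y)).
exact: implyP (all_iota (all_iota cP (ltn_ord x)) (ltn_ord y)) xy.
Qed.

Lemma a4_graph_chromatic_number : chromatic_number a4_graph = 4.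
Proof.
rewrite /chromatic_number; case: ex_minnP => k ck kmin.
apply/eqP; rewrite eqn_leq kmin ?a4_graph_colorable4 //= ltnNge.
by apply: contra a4_graph_not_colorable3 => k3; apply: colorable_widen ck.
Qed.

(** * The least order *)

(** Excluded middle replaces a decision procedure for [P]: the existence of a
    graph of a given order is not stated as a boolean. *)
Lemma exists_least (P : nat -> Prop) n :
  P n -> exists m, P m /\ forall k, P k -> m <= k.
Proof.
elim/ltn_ind: n => n IHn Pn.
have [[k [kn Pk]]|none] := classic (exists k, k < n /\ P k).
  exact: IHn Pk.
exists n; split=> // k Pk; rewrite leqNgt; apply/negP=> kn.
by apply: none; exists k.
Qed.

Theorem theorem1 :
  (exists G : sgraph,
     [/\ #|G| = 64, girth G = Some 6 & chromatic_number G = 4]) /\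
  (exists n : nat, is_min_order 6 4 n /\ n <= 64).
Proof.
have order: #|a4_graph| = 64 by rewrite card_ord.
split.
  by exists a4_graph; rewrite a4_graph_girth a4_graph_chromatic_number.
have ord64: chromatic_girth_order 6 4 64.
  exists a4_graph; split=> //; first exact: a4_graph_chromatic_number.
  by rewrite /girth_at_least a4_graph_girth.
have [n [nP nmin]] := exists_least ord64.
by exists n; split; [split | apply: nmin].
Qed.
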